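(* Let $\pi=(d_0,\ldots,d_{n-1})$ and $\pi'=(d'_0,\ldots,d'_{n'-1})$ be two distinct tree sequences, each written in non-increasing order, with $n\le n'$ and $\sum_{i=0}^{j} d_i\le\sum_{i=0}^{j} d'_i$ for all $j=0,\ldots,n-1$ (written $\pi\lhd\pi'$). Let $G$ be an extremal tree in $\mathcal{T}_\pi$ and $G'$ an extremal tree in $\mathcal{T}_{\pi'}$. Then $\lambda(G)<\lambda(G')$.
   Context: For a graph $G=(V,E)$ the Laplacian is $L(G)=D(G)-A(G)$, where $A(G)$ is the adjacency matrix and $D(G)$ the diagonal matrix of vertex degrees. $\lambda(G)$ denotes the largest eigenvalue of $L(G)$. A tree sequence is the degree sequence of some tree; $\mathcal{T}_\pi$ is the set of all trees with degree sequence $\pi$. A tree in $\mathcal{T}_\pi$ is extremal if it has the largest value of $\lambda$ among all trees in $\mathcal{T}_\pi$. *)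

(* Defs.v *)
From HB Require Import structures.
From mathcomp Require Import all_boot all_order all_algebra.
Set Implicit Arguments. Unset Strict Implicit. Unset Printing Implicit Defensive.
Import Order.TTheory GRing.Theory Num.Theory.

Definition simple_graph n (e : rel 'I_n) : Prop :=
  (forall x y, e x y = e y x) /\ (forall x, ~~ e x x).

Definition acyclic n (e : rel 'I_n) : Prop :=
  forall s : seq 'I_n, uniq s -> 2 < size s -> ~~ cycle e s.

Definition connected n (e : rel 'I_n) : Prop :=
  forall x y : 'I_n, connect e x y.

Definition is_tree n (e : rel 'I_n) : Prop :=
  0 < n /\ simple_graph e /\ connected e /\ acyclic e.

Definition deg n (e : rel 'I_n) (i : 'I_n) : nat := #|[set j | e i j]|.

Definition has_deg_seq n (e : rel 'I_n) (pi : seq nat) : Prop :=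
  perm_eq [seq deg e i | i <- enum 'I_n] pi.

Definition in_T (pi : seq nat) (e : rel 'I_(size pi)) : Prop :=
  is_tree e /\ has_deg_seq e pi.

Arguments in_T : clear implicits.

Definition tree_seq (pi : seq nat) : Prop := exists e, in_T pi e.

Local Open Scope ring_scope.

Definition adjmx (R : ringType) n (e : rel 'I_n) : 'M[R]_n :=
  \matrix_(i, j) (e i j)%:R.

Definition degmx (R : ringType) n (e : rel 'I_n) : 'M[R]_n :=
  \matrix_(i, j) (if i == j then (deg e i)%:R else 0).

Definition laplacian (R : ringType) n (e : rel 'I_n) : 'M[R]_n :=
  degmx R e - adjmx R e.

Definition is_lambda (R : rcfType) n (e : rel 'I_n) (l : R) : Prop :=
  eigenvalue (laplacian R e) l /\
  (forall m : R, eigenvalue (laplacian R e) m -> m <= l).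

Definition extremal (R : rcfType) (pi : seq nat) (e : rel 'I_(size pi)) : Prop :=
  in_T pi e /\
  forall (f : rel 'I_(size pi)) (le lf : R),
    in_T pi f -> is_lambda e le -> is_lambda f lf -> lf <= le.

Arguments extremal : clear implicits.

Definition majorized (pi pi' : seq nat) : Prop :=
  (size pi <= size pi')%N /\
  forall j : nat, (j < size pi)%N ->
    (\sum_(i < j.+1) nth 0%N pi i <= \sum_(i < j.+1) nth 0%N pi' i)%N.

(* Main.v *)
Require Import Defs.
From HB Require Import structures.
From mathcomp Require Import all_boot all_order all_algebra.
From mathcomp Require Import fingroup perm sesquilinear spectral complex.
From mathcomp Require Import ring lra zify.
Set Implicit Arguments. Unset Strict Implicit. Unset Printing Implicit Defensive.
Import Order.TTheory GRing.Theory Num.Theory.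
Local Open Scope ring_scope.

(** A tree is bipartite, so its Laplacian is similar to the signless Laplacian
    D + A, whose largest eigenvalue is the maximum of the Rayleigh quotient of
    sum over the edges xy of (f x + f y)^2 and is attained at a positive f.
    Hence the eigenvalue strictly grows when a leaf is added, and when
    neighbours of w lying off the path from v to w are moved from w to v,
    provided f w <= f v.

    If deg w <= deg v, a unit of degree can be transferred from w to v with a
    growth of the eigenvalue, whichever of f v, f w is larger: if f w <= f v
    move one neighbour from w to v, otherwise move deg v + 1 - deg w neighbours
    from v to w and exchange the two labels.

    Writing a degree as 1 + excess, padded with zeros, pi is below pi' iff every
    partial sum of the excesses of pi is at most that of pi'.  If the two
    differ, let i be the first index where they do; raising entry i by one, and
    lowering the first later entry j at which the partial sums agree (if there
    is one), keeps the sequence sorted and dominated.  These steps are realised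
    by adding a leaf at i and by a transfer from j to i respectively. *)

(** * Rayleigh bound for symmetric matrices *)

(** Writing [A] as P^-1 D P with P unitary, the coordinates [x *m invmx P] turn the form into the
    sum of the d_i |y_i|^2. *)
Lemma hermitian_rayleigh (C : numClosedFieldType) n (A : 'M[C]_n) :
    A \is hermsymmx ->
  exists d : 'I_n -> C,
    [/\ forall i, d i \is Num.real, forall i, eigenvalue A (d i) &
     forall (l : C) (x : 'rV[C]_n), (forall i, d i <= l) ->
      (x *m A *m map_mx Num.conj x^T) 0 0 <= l * (x *m map_mx Num.conj x^T) 0 0].
Proof.
move=> hA; have /orthomx_spectralP AE := hermitian_normalmx hA.
have /mxOverP dreal := hermitian_spectral_diag_real hA.
set P := spectralmx A in AE; set D := spectral_diag A in AE dreal.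
have PU : P \is unitarymx by exact: spectral_unitarymx.
have iP : invmx P = map_mx Num.conj P^T by exact: invmx_unitary.
exists (D 0); split=> [i|i|l x hl]; first exact: dreal.
  apply/eigenvalueP; exists (row i P).
    rewrite -row_mul AE !mulmxA mulmxV ?spectral_unit // mul1mx.
    by rewrite row_mul row_diag_mx -scalemxAl -rowE.
  apply/eqP => /(congr1 (fun u => u *m invmx P)).
  rewrite -row_mul mulmxV ?spectral_unit // mul0mx => /rowP/(_ i).
  by rewrite !mxE eqxx => /eqP; rewrite oner_eq0.
pose y := x *m invmx P.
have yE : map_mx Num.conj y^T = P *m map_mx Num.conj x^T.
  rewrite /y trmx_mul map_mxM iP; congr (_ *m _).
  by apply/matrixP => i j; rewrite !mxE /= conjCK.
have -> : x *m A *m map_mx Num.conj x^T = y *m diag_mx D *m map_mx Num.conj y^T.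
  by rewrite yE AE /y !mulmxA.
have -> : x *m map_mx Num.conj x^T = y *m map_mx Num.conj y^T.
  by rewrite yE /y !mulmxA mulmxKV // spectral_unit.
rewrite !mxE mulr_sumr; apply: ler_sum => i _.
rewrite mul_mx_diag !mxE [X in X * _]mulrC -!mulrA.
by apply: ler_wpM2r => //; rewrite mul_conjC_ge0.
Qed.

(** The spectral theorem is applied over [R[i]]; the eigenvalues found there are real, hence come
    from [R]. *)
Lemma symmetric_rayleigh (R : rcfType) n (A : 'M[R]_n) : A^T = A ->
  exists d : 'I_n -> R, (forall i, eigenvalue A (d i)) /\
    forall (l : R) (x : 'rV[R]_n), (forall i, d i <= l) ->
      (x *m A *m x^T) 0 0 <= l * (x *m x^T) 0 0.
Proof.
move=> symA; pose toC m k : 'M[R]_(m, k) -> 'M[R[i]]_(m, k) := map_mx (real_complex R).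
have realC m k (B : 'M[R]_(m, k)) : toC _ _ B \is a mxOver Num.real.
  by apply/mxOverP => i j; rewrite mxE; apply/complex_realP; eexists.
have conjB m k (B : 'M[R]_(m, k)) : map_mx Num.conj (toC _ _ B) = toC _ _ B.
  by apply: realmxC; exact: realC.
have [|d [dreal dA dR]] := @hermitian_rayleigh R[i] n (toC _ _ A).
  apply: realsym_hermsym; last exact: realC.
  by apply/is_hermitianmxP; rewrite expr0 scale1r map_mx_id // /toC map_trmx symA.
have dE i : d i = (complex.Re (d i))%:C%C by rewrite RRe_real.
exists (fun i => complex.Re (d i)); split=> [i|l x hl].
  by rewrite -(eigenvalue_map (real_complex R)) -[X in eigenvalue _ X]dE dA.
have := dR l%:C%C (toC _ _ x); rewrite {1 2}/toC map_trmx -/(toC _ _ _) conjB.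
rewrite /toC -!map_mxM ![(map_mx _ _) 0 0]mxE -rmorphM lecR; apply=> i.
by rewrite dE lecR.
Qed.

(** * Trees as parent functions *)

Definition parent_rel n (r : 'I_n) (p : 'I_n -> 'I_n) : rel 'I_n :=
  fun x y => (x != r) && (y == p x) || (y != r) && (x == p y).

(** Following [p] lowers [h] and so ends at [r], whence connectedness. On a cycle, both neighbours
    of a vertex of maximal [h] would have to be its parent. *)
Lemma parent_rel_tree n (e : rel 'I_n) r p (h : 'I_n -> nat) :
    e =2 parent_rel r p -> (forall x, x != r -> (h (p x) < h x)%N) ->
  is_tree e.
Proof.
move=> eE hp; have symE x y : e x y = e y x by rewrite !eE /parent_rel orbC.
split; first exact: leq_ltn_trans (ltn_ord r).
split; [split=> // x|split].
- rewrite eE /parent_rel orbb; apply/negP => /andP[/hp + /eqP xE].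
  by rewrite -xE ltnn.
- have toroot x : connect e x r.
    have [m] := ubnP (h x); elim: m x => // m IH x hx.
    have [->|xr] := eqVneq x r; first exact: connect0.
    apply: (@connect_trans _ _ (p x)).
      by apply: connect1; rewrite eE /parent_rel xr eqxx.
    by apply: IH; have := hp _ xr; lia.
  move=> x y; apply: connect_trans (toroot x) _.
  by rewrite (sym_connect_sym symE).
- move=> s us s3; apply/negP => cyc.
  have /hasP[x0 x0s _] : has predT s by case: s s3 {us cyc}.
  have [x xs xmax] := arg_maxnP h x0s.
  have nbr y : y \in s -> e x y -> y = p x.
    move=> ys; rewrite eE /parent_rel => /orP[/andP[_ /eqP//]|].
    by case/andP => /hp + /eqP xE; rewrite -xE => /leq_trans/(_ (xmax _ ys)); rewrite ltnn.
  have [i s' sE] := rot_to xs.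
  have: path.cycle e (rot i s) by rewrite rot_cycle.
  have: uniq (rot i s) by rewrite rot_uniq.
  have: (2 < size (rot i s))%N by rewrite size_rot.
  have: {subset rot i s <= s} by move=> y; rewrite mem_rot.
  rewrite {}sE; case: s' => // y; case/lastP=> // s'' z sub _ + cycs.
  have yE : y = p x.
    apply: nbr; last by case/andP: cycs.
    by apply: sub; rewrite !inE eqxx orbT.
  have zE : z = p x.
    apply: nbr; first by apply: sub; rewrite !inE mem_rcons !inE eqxx !orbT.
    by move: cycs => /=; rewrite rcons_path last_rcons [e z x]symE => /and3P[].
  by rewrite yE zE /= mem_rcons inE eqxx !andbF.
Qed.

Fixpoint walk_to (T : finType) (e : rel T) r k x :=
  if k is k'.+1 then [exists y, walk_to e r k' y && e y x] else x == r.

(** [h] is the distance to [r] and [p] picks a neighbour one step closer. The parent edges already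
    connect all vertices, so any other edge would close a cycle. *)
Lemma tree_parent n (e : rel 'I_n) : is_tree e -> forall r, exists p h,
  [/\ e =2 parent_rel r p, h r = 0%N & forall x, x != r -> h x = (h (p x)).+1].
Proof.
move=> [n0 [[symE irrE] [conE acyE]]] r.
have reachS k x y : walk_to e r k x -> e x y -> walk_to e r k.+1 y.
  by move=> rx exy; apply/existsP; exists x; apply/andP.
have reachE x : exists k, walk_to e r k x.
  have /connectP[q] := conE r x; elim/last_ind: q x => [x _ ->|q y IH x].
    by exists 0%N; exact: eqxx.
  rewrite rcons_path last_rcons => /andP[/IH/(_ erefl)[k rk] ey ->].
  by exists k.+1; exact: reachS ey.
pose h x := ex_minn (reachE x).
have hP x : walk_to e r (h x) x by rewrite /h; case: ex_minnP.
have hmin x k : walk_to e r k x -> (h x <= k)%N by rewrite /h; case: ex_minnP => m _; apply.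
pose p x := odflt r [pick y | e y x && (h x == (h y).+1)].
have pP x : x != r -> e (p x) x /\ h x = (h (p x)).+1.
  rewrite /p; case: pickP => [y /andP[? /eqP?] //|no xr].
  case hx : (h x) (hP x) => [|k] /=; first by rewrite (negPf xr).
  case/existsP => y /andP[ry exy]; have := no y.
  rewrite exy hx eqSS /= eqn_leq (hmin _ _ ry) andbT => /negP[].
  by rewrite -ltnS -hx; apply/hmin/(reachS _ y).
have sub x y : parent_rel r p x y -> e x y.
  by case/orP => /andP[/pP[+ _] /eqP ->]; rewrite // symE.
have [||_ [_ [con' _]]] := @parent_rel_tree n (parent_rel r p) r p h => //.
  by move=> x /pP[_ ->].
exists p, h; split=> [x y||x /pP[]//]; last by apply/eqP; rewrite -leqn0 hmin /=.
apply/idP/idP; last exact: sub.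
apply: contraTT => nexy; apply/negP => exy.
have /connectP[q pq yE] := con' x y.
case/shortenP: pq yE => q' pq' uq' _ yE.
have: (2 < size (x :: q'))%N.
  case: q' pq' yE {uq'} => [_ yx|z [|//]] /=; first by rewrite yx (negPf (irrE x)) in exy.
  by rewrite andbT => + yz; rewrite -yz (negPf nexy).
move/(acyE _ uq') => /negP; apply.
by rewrite /= rcons_path -yE symE exy andbT; apply: sub_path pq'.
Qed.

(** Each edge is the parent edge of exactly one vertex, because the decrease of [h] prevents two
    vertices from being each other's parent. *)
Lemma parent_rel_sum (V : nmodType) n (e : rel 'I_n) r p (h : 'I_n -> nat)
    (F : 'I_n -> 'I_n -> V) :
    e =2 parent_rel r p -> (forall x, x != r -> (h (p x) < h x)%N) ->
  \sum_x \sum_(y | e x y) F x y = \sum_(x | x != r) (F x (p x) + F (p x) x).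
Proof.
move=> eE hp.
transitivity (\sum_x (\sum_(y | (x != r) && (y == p x)) F x y +
                      \sum_(y | (y != r) && (x == p y)) F x y)).
  apply: eq_bigr => x _; rewrite (bigID (fun y => (x != r) && (y == p x))) /=.
  congr (_ + _); apply: eq_bigl => y; rewrite eE /parent_rel.
    by case: ((x != r) && (y == p x)); rewrite ?andbF.
  have [/andP[xr /eqP ->]|] /= := boolP ((x != r) && (y == p x)); last by rewrite andbT.
  symmetry; apply/negP => /andP[/hp + /eqP xE]; rewrite -xE.
  by have := hp _ xr; lia.
rewrite !big_split /= [X in _ + X](exchange_big_dep predT) //=; congr (_ + _).
  rewrite [RHS]big_mkcond; apply: eq_bigr => x _.
  by case: eqP => _ /=; [rewrite big_pred0|rewrite big_pred1_eq].
rewrite [RHS]big_mkcond; apply: eq_bigr => x _.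
by case: eqP => _ /=; [rewrite big_pred0|rewrite big_pred1_eq].
Qed.

Lemma parent_rel_deg n (e : rel 'I_n) r p (h : 'I_n -> nat) :
    e =2 parent_rel r p -> (forall x, x != r -> (h (p x) < h x)%N) ->
  forall x, deg e x = ((x != r) + #|[set y | (y != r) && (p y == x)]|)%N.
Proof.
move=> eE hp x; rewrite /deg; set C := [set y | (y != r) && _].
have [xr|xr] := eqVneq x r.
  congr #|pred_of_set _|; apply/setP => y.
  by rewrite !inE eE /parent_rel xr eqxx [r == _]eq_sym.
have -> : [set y | e x y] = p x |: C.
  by apply/setP => y; rewrite !inE eE /parent_rel xr [x == _]eq_sym.
rewrite cardsU1 inE; congr (~~ _ + _)%N; apply/negbTE/negP => /andP[/hp + /eqP pE].
by rewrite pE; have := hp _ xr; lia.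
Qed.

Lemma tree_handshake n (e : rel 'I_n) : is_tree e -> (\sum_x deg e x).+2 = n.*2.
Proof.
move=> te; have r : 'I_n := Ordinal te.1.
have [p [h [eE _ hp]]] := tree_parent te r.
have hlt x : x != r -> (h (p x) < h x)%N by move/hp ->.
have E := parent_rel_sum (fun _ _ => 1%N) eE hlt.
have -> : \sum_x deg e x = (\sum_x \sum_(y | e x y) 1)%N.
  by apply: eq_bigr => x _; rewrite sum1_card /deg cardsE.
have -> : (\sum_x \sum_(y | e x y) 1 = n.-1 * 2)%N.
  by rewrite -[in RHS](card_ord n) -(cardC1 r) -sum_nat_const; exact: E.
by have := ltn_ord r; lia.
Qed.

(** * Energy of a vector and moving of neighbours *)

Section Energy.
Variable R : rcfType.

(* Both orientations of an edge are summed: this is twice the quadratic form of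
   the signless Laplacian, whence the factor 2 * l in the bounds below. *)
Definition energy n (e : rel 'I_n) (f : 'I_n -> R) :=
  \sum_x \sum_(y | e x y) (f x + f y) ^+ 2.

Definition sqnorm n (f : 'I_n -> R) := \sum_(x < n) f x ^+ 2.

Definition signless_lapl n (e : rel 'I_n) (f : 'I_n -> R) v := \sum_(y | e v y) (f v + f y).

(* Rooted at v, the neighbours of w off the path to v are the children of w, and
   moving some of them to v is a change of parent. *)
Lemma tree_shift n (e : rel 'I_n) v w k :
    is_tree e -> v != w -> (0 < k < deg e w)%N ->
  exists e' : rel 'I_n,
    [/\ is_tree e', deg e' v = (deg e v + k)%N, deg e' w = (deg e w - k)%N,
        forall x, x != v -> x != w -> deg e' x = deg e x &
        forall f : 'I_n -> R, (forall x, 0 < f x) -> f w <= f v ->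
          energy e f <= energy e' f /\ signless_lapl e f v < signless_lapl e' f v].
Proof.
move=> te vw /andP[k0 kw].
have [p [h [eE hv hp]]] := tree_parent te v.
have hlt x : x != v -> (h (p x) < h x)%N by move/hp ->.
have degE := parent_rel_deg eE hlt.
have := degE w; rewrite eq_sym vw; set C := [set y | _] => dw.
(* Since [w] is not the root, it has [deg e w - 1] children, which is at least [k]; any [k] of them
   will do. *)
pose U := [set:: take k (enum C)].
have UC : U \subset C.
  by apply/subsetP => u; rewrite inE => /mem_take; rewrite mem_enum.
have cU : #|U| = k.
  rewrite cardsE (card_uniqP _) ?take_uniq ?enum_uniq // size_takel // -cardE.
  by rewrite -ltnS; move: kw; rewrite dw.
have UP u : u \in U -> u != v /\ p u = w.
  by move/(subsetP UC); rewrite inE => /andP[-> /eqP].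
pose p' x := if x \in U then v else p x.
have hlt' x : x != v -> (h (p' x) < h x)%N.
  by move=> xv; rewrite /p'; case: ifP => _; [rewrite hv hp|exact: hlt].
have degE' := parent_rel_deg (fun x y => erefl (parent_rel v p' x y)) hlt'.
exists (parent_rel v p'); split.
- exact: (parent_rel_tree (h := h)).
- rewrite degE' degE eqxx !add0n -cU -cardsUI.
  set A := [set y | _]; set B := [set y | _].
  have -> : B :&: U = set0.
    apply/setP => u; rewrite in_setI in_set0 in_set.
    apply/negP => /andP[/andP[_ /eqP pv] /UP[_]].
    by rewrite pv => /eqP; rewrite (negPf vw).
  rewrite cards0 addn0; congr #|pred_of_set _|; apply/setP => u.
  rewrite in_setU [u \in A]in_set [u \in B]in_set /p'.
  case: ifP => [/UP[-> _]|_]; first by rewrite eqxx orbT.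
  by rewrite orbF.
- rewrite degE' degE eq_sym vw -addnBA ?cU //; last first.
    by rewrite -cU subset_leq_card.
  congr (_ + _)%N; rewrite -/C -cU -[in RHS](setIidPr UC) -cardsD.
  congr #|pred_of_set _|; apply/setP => u; rewrite in_setD [u \in C]in_set [LHS]in_set /p'.
  by case: ifP => _ //=; rewrite (negPf vw) andbF.
- move=> x xv xw; rewrite degE' degE; congr (_ + _)%N.
  congr #|pred_of_set _|; apply/setP => u; rewrite !in_set /p'.
  case: ifP => // /UP[_ ->].
  by rewrite ![_ == x]eq_sym (negPf xv) (negPf xw).
move=> f f0 fwv; split.
  rewrite /energy (parent_rel_sum _ eE hlt).
  rewrite (parent_rel_sum _ (fun x y => erefl (parent_rel v p' x y)) hlt').
  apply: ler_sum => x _; rewrite /p'; case: ifP => // /UP[_ ->].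
  have := f0 x; have := f0 v; have := f0 w; nra.
(* The old neighbours of [v] are kept and [u] is a new one, contributing [f v + f u > 0]. *)
have /card_gt0P[u uU] : (0 < #|U|)%N by rewrite cU.
have [uv pu] := UP _ uU.
rewrite /signless_lapl [ltRHS](bigD1 u) /=; last first.
  by rewrite /parent_rel uv /p' uU eqxx orbT.
apply: (@le_lt_trans _ _ (\sum_(i | parent_rel v p' v i && (i != u)) (f v + f i))); last first.
  by rewrite ltrDr addr_gt0.
rewrite big_mkcond [leRHS]big_mkcond /=; apply: ler_sum => i _.
rewrite eE /parent_rel eqxx /=; case: ifP => [/andP[iv /eqP vi]|_]; last first.
  by case: ifP => // _; rewrite ltW // addr_gt0.
have iU : i \notin U by apply/negP => /UP[_ pi]; move: vw; rewrite vi pi eqxx.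
rewrite /p' (negPf iU) iv -vi eqxx /=; case: eqP => // iu.
by rewrite iu uU in iU.
Qed.
End Energy.

(** * The largest eigenvalue of a tree *)

Lemma edge_sum_swap (V : nmodType) n (e : rel 'I_n) (F : 'I_n -> 'I_n -> V) :
    symmetric e ->
  \sum_x \sum_(y | e x y) F x y = \sum_x \sum_(y | e x y) F y x.
Proof.
move=> symE; rewrite (exchange_big_dep predT) //=.
by apply: eq_bigr => x _; apply: eq_bigl => y; rewrite symE.
Qed.

Section Spectrum.
Variable R : rcfType.

Lemma mul_laplacian n (e : rel 'I_n) (x : 'rV[R]_n) v : symmetric e ->
  (x *m laplacian R e) 0 v = \sum_(y | e v y) (x 0 v - x 0 y).
Proof.
move=> symE; rewrite mulmxBr mxE [X in _ + X]mxE !mxE sumrB; congr (_ - _).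
  rewrite (bigD1 v) //= !mxE eqxx big1 ?addr0 => [|y /negPf yv].
    by rewrite sumr_const mulr_natr /deg cardsE.
  by rewrite mxE yv mulr0.
rewrite [RHS]big_mkcond; apply: eq_bigr => y _; rewrite mxE symE.
by case: (e v y); rewrite ?mulr1 ?mulr0.
Qed.

Lemma laplacian_form n (e : rel 'I_n) (x : 'rV[R]_n) : symmetric e ->
  \sum_v \sum_(y | e v y) (x 0 v - x 0 y) ^+ 2 =
  2 * (x *m laplacian R e *m x^T) 0 0.
Proof.
move=> symE.
have -> : (x *m laplacian R e *m x^T) 0 0 =
    \sum_v \sum_(y | e v y) (x 0 v - x 0 y) * x 0 v.
  rewrite mxE; apply: eq_bigr => v _.
  by rewrite (mul_laplacian _ _ symE) mxE mulr_suml.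
rewrite mulr_natl mulr2n [X in _ = _ + X](edge_sum_swap _ symE) -big_split.
apply: eq_bigr => v _; rewrite -big_split; apply: eq_bigr => y _ /=; ring.
Qed.

Lemma laplacian_sym n (e : rel 'I_n) : symmetric e ->
  (laplacian R e)^T = laplacian R e.
Proof.
move=> symE; apply/matrixP => i j; rewrite !mxE symE eq_sym.
by case: eqP => // ->.
Qed.

(** The largest of the [d i] bounds the Rayleigh quotient, hence every eigenvalue. *)
Lemma lambda_exists n (e : rel 'I_n) : is_tree e -> exists l : R, is_lambda e l.
Proof.
move=> [n0 [[symE _] _]].
have [d [dE dR]] := symmetric_rayleigh (laplacian_sym symE).
have [i _ imax] := @arg_maxP _ _ _ (Ordinal n0) predT d erefl.
exists (d i); split=> // m /eigenvalueP[x xE x0].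
have := dR (d i) x (fun j => imax j erefl).
rewrite xE -scalemxAl mxE ler_pM2r // mxE lt_neqAle sumr_ge0 => [|j _]; last first.
  by rewrite mxE -expr2 sqr_ge0.
rewrite andbT eq_sym psumr_eq0 => [|j _]; last by rewrite mxE -expr2 sqr_ge0.
apply: contra x0 => /allP x0; apply/eqP/rowP => j; rewrite mxE.
by have := x0 j (mem_index_enum _); rewrite mxE -expr2 sqrf_eq0 => /eqP.
Qed.

Lemma sqnormE n (x : 'rV[R]_n) : (x *m x^T) 0 0 = sqnorm (x 0).
Proof. by rewrite mxE; apply: eq_bigr => v _; rewrite mxE expr2. Qed.

(** Alternating the signs of [f] turns the sums over edges into differences, to which the Rayleigh
    bound for the Laplacian applies. *)
Lemma tree_energy_le n (e : rel 'I_n) (l : R) : is_tree e -> is_lambda e l ->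
  forall f, energy e f <= 2 * l * sqnorm f.
Proof.
move=> te [_ lmax] f; have [n0 [[symE _] _]] := te.
have [d [dE dR]] := symmetric_rayleigh (laplacian_sym symE).
have [p [h [eE _ hp]]] := tree_parent te (Ordinal n0).
(* The parity of the depth h is a proper 2-colouring. *)
pose x : 'rV[R]_n := \row_v ((-1) ^+ h v * f v).
have := dR l x (fun i => lmax _ (dE i)).
rewrite -(ler_pM2l (ltr0n R 2)) -laplacian_form // sqnormE mulrA.
have -> : sqnorm (x 0) = sqnorm f.
  by apply: eq_bigr => v _; rewrite mxE exprMn sqrr_sign mul1r.
apply: le_trans; apply: ler_sum => v _; apply: ler_sum => y.
have aux a b : a != Ordinal n0 -> b == p a -> (-1) ^+ h a = - (-1) ^+ h b :> R.
  by move=> /hp-> /eqP->; rewrite exprS mulN1r.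
have sqr1 a : ((-1) ^+ h a) ^+ 2 = 1 :> R by rewrite sqrr_sign.
rewrite !mxE eE => /orP[]/andP[ar pa]; rewrite (aux _ _ ar pa).
  by rewrite mulNr -opprD -mulrDr sqrrN exprMn sqr1 mul1r addrC.
by rewrite mulNr opprK -mulrDr exprMn sqr1 mul1r.
Qed.

(* Perturbing f at the single vertex v cannot raise the Rayleigh quotient, so the
   first-order term in the perturbation vanishes. *)
Lemma energy_max_eigen n (e : rel 'I_n) (l : R) f : symmetric e ->
    (forall g, energy e g <= 2 * l * sqnorm g) -> 2 * l * sqnorm f <= energy e f ->
  forall v, signless_lapl e f v = l * f v.
Proof.
move=> symE emax fmax v; pose d (x : 'I_n) : R := (x == v)%:R.
have dsum (F : 'I_n -> R) : \sum_x F x * d x = F v.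
  rewrite (bigD1 v) //= /d eqxx mulr1 big1 ?addr0 // => x /negPf ->.
  by rewrite mulr0.
have energyD t : energy e (fun x => f x + t * d x) =
    energy e f + 4 * t * signless_lapl e f v + t ^+ 2 * energy e d.
  have -> : 4 * t * signless_lapl e f v =
      2 * t * (\sum_x \sum_(y | e x y) (f x + f y) * (d x + d y)).
    have -> : \sum_x \sum_(y | e x y) (f x + f y) * (d x + d y) =
        2 * \sum_x \sum_(y | e x y) (f x + f y) * d x.
      rewrite mulr_natl mulr2n [X in _ = _ + X](edge_sum_swap _ symE) -big_split.
      by apply: eq_bigr => x _; rewrite -big_split; apply: eq_bigr => y _ /=; ring.
    under [X in _ = _ * (_ * X)]eq_bigr => x _ do rewrite -mulr_suml.
    by rewrite dsum /signless_lapl; ring.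
  rewrite /energy !mulr_sumr -!big_split; apply: eq_bigr => x _ /=.
  by rewrite !mulr_sumr -!big_split; apply: eq_bigr => y _ /=; ring.
have sqnormD t : sqnorm (fun x => f x + t * d x) = sqnorm f + 2 * t * f v + t ^+ 2.
  rewrite -{1}(dsum f) -[t ^+ 2]mulr1 -[in X in _ + X](dsum (fun _ => 1)).
  rewrite /sqnorm !mulr_sumr -!big_split; apply: eq_bigr => x _ /=.
  by rewrite /d; case: (x == v) => /=; ring.
set a := signless_lapl e f v; set c := energy e d.
(* This choice gives [|s * (c - 2 * l)| <= 1]. With [b = a - l * f v], perturbing by [s * b] changes
   energy minus [2 * l] times [sqnorm] by [b ^+ 2 * (4 + s * (c - 2 * l)) * s], whose middle factor
   is at least 3; hence [b = 0]. *)
pose s := (1 + `|c - 2 * l|)^-1.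
have s0 : 0 < 1 + `|c - 2 * l| by rewrite ltr_wpDr // normr_ge0.
have := emax (fun x => f x + s * (a - l * f v) * d x); rewrite energyD sqnormD -/a -/c.
set b := a - l * f v => le0.
have {le0} : b ^+ 2 * (4 + s * (c - 2 * l)) * s <= 0.
  by move: le0 fmax; rewrite /b; move: (energy _ _) (sqnorm _) => E N; nra.
rewrite pmulr_lle0 ?invr_gt0 // pmulr_lle0; last first.
  have : `|s * (c - 2 * l)| <= 1.
    by rewrite normrM /s normfV (gtr0_norm s0) ler_pdivrMl // mulr1 lerDr.
  by rewrite ler_norml => /andP[? _]; lra.
move=> b2; have : b == 0 by rewrite -sqrf_eq0 eq_le b2 sqr_ge0.
by rewrite subr_eq0 => /eqP.
Qed.

(** Take for [f] the absolute value of a Laplacian eigenvector [x] for [l]: since |x_v - x_y| is at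
    most [f v + f y], it attains the maximal energy. A zero of [f] would spread to its neighbours,
    hence everywhere. *)
Lemma tree_perron n (e : rel 'I_n) (l : R) : is_tree e -> is_lambda e l ->
  exists f, (forall x, 0 < f x) /\ forall v, signless_lapl e f v = l * f v.
Proof.
move=> te el; have [n0 [[symE _] [conE _]]] := te.
have [/eigenvalueP[x xE x0] _] := el.
pose f v := `|x 0 v|; exists f.
have fE : forall v, signless_lapl e f v = l * f v.
  apply: energy_max_eigen => //; first exact: tree_energy_le.
  have -> : sqnorm f = sqnorm (x 0).
    by apply: eq_bigr => v _; rewrite /f real_normK // num_real.
  rewrite -sqnormE -mulrA.
  have -> : l * (x *m x^T) 0 0 = (x *m laplacian R e *m x^T) 0 0.
    by rewrite xE -scalemxAl [RHS]mxE.
  rewrite -laplacian_form //; apply: ler_sum => v _; apply: ler_sum => y _.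
  by rewrite -[leLHS]real_normK ?num_real // lerXn2r ?nnegrE ?addr_ge0 ?normr_ge0 // ler_normB.
split=> // v; rewrite lt_neqAle normr_ge0 andbT eq_sym; apply: contra x0 => fv0.
have step a b : f a = 0 -> e a b -> f b = 0.
  move=> fa eab; have := fE a; rewrite fa mulr0 /signless_lapl.
  under eq_bigr do rewrite fa add0r.
  by move/psumr_eq0P => ->  // i _; exact: normr_ge0.
apply/eqP/rowP => y; rewrite mxE; apply/eqP; rewrite -normr_eq0 -/(f y).
have /connectP[q] := conE v y; move/eqP: fv0.
elim: q v => [v fv0 _ -> /=|a q IH v fv0 /= /andP[eva pa]]; first by rewrite fv0.
exact/IH/pa/(step v).
Qed.

(** Were [l' <= l], the vector [f] would attain the energy bound for [l] and so satisfy the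
    eigenvalue equation at [v]. Thus a weak gain in energy with a strict gain at one vertex
    suffices. *)
Lemma lambda_gt n (e : rel 'I_n) (l l' : R) f v : is_tree e -> is_lambda e l' ->
  2 * l * sqnorm f <= energy e f -> l * f v < signless_lapl e f v -> l < l'.
Proof.
move=> te el' le1; rewrite ltNge => lt2; rewrite ltNge; apply: contra lt2 => le2.
rewrite (@energy_max_eigen _ _ l) //; first by case: te => _ [[]].
move=> g; apply: le_trans (tree_energy_le te el' g) _.
by apply: ler_wpM2r; [apply: sumr_ge0 => x _; exact: sqr_ge0|lra].
Qed.
End Spectrum.

(** * Operations that raise the largest eigenvalue *)

(** The leaf gets the last index, so the old vertices keep their places in the degree sequence. *)
Definition add_leaf n (e : rel 'I_n) v : rel 'I_n.+1 := fun x y =>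
  match unlift ord_max x, unlift ord_max y with
  | Some a, Some b => e a b
  | Some a, None => a == v
  | None, Some b => b == v
  | None, None => false
  end.

Lemma add_leaf_tree n (e : rel 'I_n) v : is_tree e -> is_tree (add_leaf e v).
Proof.
move=> te; have [p [h [eE _ hp]]] := tree_parent te v.
pose p' x := if unlift ord_max x is Some a then lift ord_max (p a) else lift ord_max v.
pose h' x := if unlift ord_max x is Some a then h a else (h v).+1.
apply: (@parent_rel_tree _ _ (lift ord_max v) p' h') => [x y|x].
  have nl (a : 'I_n) : (ord_max == lift (ord_max : 'I_n.+1) a) = false.
    by apply/negbTE; exact: neq_lift.
  rewrite /add_leaf /parent_rel /p'.
  case: (unliftP ord_max x) => [a|] ->; case: (unliftP ord_max y) => [b|] ->;
    rewrite ?nl ?(inj_eq lift_inj) ?andbF ?orbF //.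
rewrite /h' /p'; case: (unliftP ord_max x) => [a|] ->; rewrite liftK //.
by rewrite (inj_eq lift_inj) => /hp ->.
Qed.

Lemma sum_ord_lift_max (V : nmodType) n (P : pred 'I_n.+1) (F : 'I_n.+1 -> V) :
  \sum_(i | P i) F i =
  \sum_(i | P (lift ord_max i)) F (lift ord_max i) + (if P ord_max then F ord_max else 0).
Proof.
rewrite big_mkcond big_ord_recr [in RHS]big_mkcond /=; congr (_ + _).
apply: eq_bigr => i _.
have -> // : widen_ord (leqnSn n) i = lift ord_max i.
by apply/val_inj; symmetry; exact: lift_max.
Qed.

Lemma degE n (e : rel 'I_n) x : deg e x = \sum_(y | e x y) 1%N.
Proof. by rewrite /deg cardsE -sum1_card. Qed.

Section AddLeaf.
Variables (n : nat) (e : rel 'I_n) (v : 'I_n).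

Lemma add_leafLL x y : add_leaf e v (lift ord_max x) (lift ord_max y) = e x y.
Proof. by rewrite /add_leaf !liftK. Qed.

Lemma add_leafLM x : add_leaf e v (lift ord_max x) ord_max = (x == v).
Proof. by rewrite /add_leaf liftK unlift_none. Qed.

Lemma add_leafML x : add_leaf e v ord_max (lift ord_max x) = (x == v).
Proof. by rewrite /add_leaf liftK unlift_none. Qed.

Lemma add_leafMM : add_leaf e v ord_max ord_max = false.
Proof. by rewrite /add_leaf unlift_none. Qed.

Lemma add_leaf_deg_lift x : deg (add_leaf e v) (lift ord_max x) = (deg e x + (x == v))%N.
Proof.
rewrite !degE sum_ord_lift_max add_leafLM; congr (_ + _).
by apply: eq_bigl => y; rewrite add_leafLL.
Qed.

Lemma add_leaf_deg_max : deg (add_leaf e v) ord_max = 1%N.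
Proof.
rewrite degE sum_ord_lift_max add_leafMM addr0.
by under eq_bigl do rewrite add_leafML; rewrite big_pred1_eq.
Qed.
End AddLeaf.

Section Growth.
Variable R : rcfType.

Lemma eigen_energy n (e : rel 'I_n) (l : R) f : symmetric e ->
  (forall v, signless_lapl e f v = l * f v) -> energy e f = 2 * l * sqnorm f.
Proof.
move=> symE fE.
transitivity (2 * \sum_x \sum_(y | e x y) (f x + f y) * f x).
  rewrite mulr_natl mulr2n [X in _ = _ + X](edge_sum_swap _ symE) -big_split.
  by apply: eq_bigr => x _; rewrite -big_split; apply: eq_bigr => y _ /=; ring.
rewrite -mulrA; congr (_ * _); rewrite mulr_sumr; apply: eq_bigr => x _.
by rewrite -mulr_suml [X in X * _]fE; ring.
Qed.

(** The Perron vector, extended by 0 at the leaf, keeps its norm, loses no energy and gains [f v] at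
    [v]. *)
Lemma add_leaf_lambda n (e : rel 'I_n) v (l l' : R) : is_tree e ->
  is_lambda e l -> is_lambda (add_leaf e v) l' -> l < l'.
Proof.
move=> te el el'; have [f [f0 fE]] := tree_perron te el.
pose g x := if unlift ord_max x is Some a then f a else 0.
have gL x : g (lift ord_max x) = f x by rewrite /g liftK.
have gM : g ord_max = 0 by rewrite /g unlift_none.
apply: (@lambda_gt _ _ _ _ _ g (lift ord_max v) (add_leaf_tree v te) el').
  have -> : sqnorm g = sqnorm f.
    rewrite /sqnorm sum_ord_lift_max gM expr0n addr0.
    by apply: eq_bigr => x _; rewrite gL.
  rewrite -(eigen_energy _ fE); last by case: te => _ [[]].
  rewrite /energy sum_ord_lift_max ler_wpDr ?sumr_ge0 // => [y _|]; first exact: sqr_ge0.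
  apply: ler_sum => x _; rewrite sum_ord_lift_max ler_wpDr //.
    by case: ifP => // _; exact: sqr_ge0.
  rewrite gL; under [leRHS]eq_bigl do rewrite add_leafLL.
  by under [leRHS]eq_bigr do rewrite gL.
rewrite gL -fE /signless_lapl sum_ord_lift_max gL add_leafLM eqxx gM addr0.
under [X in _ < X + _]eq_bigl do rewrite add_leafLL.
by under [X in _ < X + _]eq_bigr do rewrite gL; rewrite ltrDl.
Qed.

Section Relabel.
Variables (n : nat) (e : rel 'I_n) (s : {perm 'I_n}).
Let es : rel 'I_n := fun x y => e (s x) (s y).

Lemma relabel_tree : is_tree e -> is_tree es.
Proof.
move=> te; have [p [h [eE _ hp]]] := tree_parent te (Ordinal te.1).
set r := Ordinal _ in eE hp.
have sE a b : (a == s^-1%g b) = (s a == b) by rewrite -[RHS](can_eq (permKV s)) permK.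
apply: (@parent_rel_tree _ _ (s^-1%g r) (fun x => s^-1%g (p (s x))) (h \o s)) => [x y|x].
  by rewrite /es eE /parent_rel !sE.
by rewrite sE /= => /hp ->; rewrite permKV.
Qed.

Lemma relabel_deg x : deg es x = deg e (s x).
Proof. by rewrite !degE [RHS](reindex_inj (@perm_inj _ s)). Qed.

Lemma relabel_sqnorm (f : 'I_n -> R) : sqnorm (f \o s) = sqnorm f.
Proof. by rewrite /sqnorm [RHS](reindex_inj (@perm_inj _ s)). Qed.

Lemma relabel_signless_lapl (f : 'I_n -> R) x :
  signless_lapl es (f \o s) x = signless_lapl e f (s x).
Proof. by rewrite /signless_lapl [RHS](reindex_inj (@perm_inj _ s)). Qed.

Lemma relabel_energy (f : 'I_n -> R) : energy es (f \o s) = energy e f.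
Proof.
rewrite /energy [RHS](reindex_inj (@perm_inj _ s)); apply: eq_bigr => x _.
by rewrite [RHS](reindex_inj (@perm_inj _ s)).
Qed.
End Relabel.

Lemma tree_transfer n (e : rel 'I_n) v w (l : R) :
    is_tree e -> is_lambda e l -> v != w -> (1 < deg e w <= deg e v)%N ->
  exists e' : rel 'I_n,
    [/\ is_tree e', deg e' v = (deg e v).+1, deg e' w = (deg e w).-1,
        forall x, x != v -> x != w -> deg e' x = deg e x &
        forall l', is_lambda e' l' -> l < l'].
Proof.
move=> te el vw /andP[w1 wv]; have [f [f0 fE]] := tree_perron te el.
have fe : 2 * l * sqnorm f = energy e f.
  by rewrite (eigen_energy _ fE) //; case: te => _ [[]].
have [fwv|fvw] := leP (f w) (f v).
  have [|e' [te' dv dw dx /(_ _ f0 fwv)[en sl]]] := @tree_shift R n e v w 1 te vw.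
    by rewrite w1.
  exists e'; split=> //; first by rewrite dv addn1.
    by rewrite dw subn1.
  move=> l' el'; apply: (lambda_gt (f := f) (v := v) te' el'); first by rewrite fe.
  by rewrite -fE.
(* Moving this many neighbours gives [w] degree [deg e v + 1] and [v] degree [deg e w - 1]; swapping
   the two labels restores the intended degrees. *)
have [||e' [te' dw dv dx /(_ _ f0 (ltW fvw))[en sl]]] :=
    @tree_shift R n e w v (deg e v + 1 - deg e w) te; first by rewrite eq_sym.
  by lia.
pose s := tperm v w; exists (fun x y => e' (s x) (s y)); split.
- exact: relabel_tree.
- by rewrite relabel_deg tpermL dw; lia.
- by rewrite relabel_deg tpermR dv; lia.
- by move=> x xv xw; rewrite relabel_deg tpermD 1?eq_sym // dx.
move=> l' el'; apply: (lambda_gt (f := f \o s) (v := v) (relabel_tree s te') el').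
  by rewrite relabel_sqnorm relabel_energy fe.
by rewrite relabel_signless_lapl /= tpermL -fE.
Qed.
End Growth.

(** * Majorization *)

Section Majorization.
Local Open Scope nat_scope.

Definition psum (f : nat -> nat) k := \sum_(i < k) f i.

Definition nonincr (f : nat -> nat) := forall i, f i.+1 <= f i.

Definition dominated f g := forall k, psum f k <= psum g k.

Lemma psumS f k : psum f k.+1 = psum f k + f k.
Proof. exact: big_ord_recr. Qed.

Lemma psum0 f : psum f 0 = 0.
Proof. exact: big_ord0. Qed.

Lemma psum_mono f j k : j <= k -> psum f j <= psum f k.
Proof.
elim: k => [|k IH]; first by rewrite leqn0 => /eqP->.
by rewrite leq_eqVlt psumS => /predU1P[->|/IH]; rewrite ?psumS //; lia.
Qed.

Lemma psum_stable f n k : (forall i, n <= i -> f i = 0) -> n <= k ->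
  psum f k = psum f n.
Proof.
move=> f0; elim: k => [|k IH]; first by rewrite leqn0 => /eqP->.
by rewrite leq_eqVlt => /predU1P[-> //|nk]; rewrite psumS f0 // addn0 IH.
Qed.

Lemma nonincr_le f i j : nonincr f -> i <= j -> f j <= f i.
Proof.
move=> fd; elim: j => [|j IH]; first by rewrite leqn0 => /eqP->.
by rewrite leq_eqVlt => /predU1P[->//|/IH]; apply: leq_trans.
Qed.

Lemma psum_pos f k : (forall i, i < k -> 0 < f i) -> k <= psum f k.
Proof.
elim: k => // k IH f0; rewrite psumS; have := f0 k (leqnn _).
by have := IH (fun i ik => f0 i (ltnW ik)); lia.
Qed.

(** [psum f i = psum g i] and [f i < g i] will place [i] among the vertices of both trees; the two
    conjuncts after them make the induction measure grow. *)
Lemma dominated_step f g n i0 :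
    nonincr f -> nonincr g -> dominated f g -> (forall i, n <= i -> f i = 0) ->
    f i0 <> g i0 ->
  exists f' i, [/\ nonincr f', dominated f' g,
    [/\ psum f i = psum g i, f i < g i, dominated f f' & psum f i.+1 < psum f' i.+1] &
    (forall k, f' k = f k + (k == i)) \/
    exists j, [/\ i < j, 0 < f j & forall k, f' k + (k == j) = f k + (k == i)]].
Proof.
move=> fd gd dom f0 /eqP ne0.
have [i nei imin] := ex_minnP (ex_intro (fun i => f i != g i) i0 ne0).
have eqlt k : k < i -> f k = g k.
  by move=> ki; apply/eqP; apply: contraLR ki; rewrite -leqNgt => /imin.
have pi : psum f i = psum g i.
  by apply: eq_bigr => k _; exact: eqlt.
have fgi : f i < g i by have := dom i.+1; rewrite !psumS pi; lia.
(* [f] drops just before [i], as [f i < g i <= g k = f k], so raising entry [i] keeps the sequence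
   sorted. *)
have fi k : k.+1 = i -> f k.+1 < f k.
  by move=> ki; have := eqlt k; have := gd k; rewrite ki; lia.
pose tight j := (i < j) && (psum f j.+1 == psum g j.+1).
have [/hasP[j1 _ tj1]|notight] := boolP (has tight (iota 0 n)).
  have [j /andP[ij /eqP pj] jmin] := ex_minnP (ex_intro tight j1 tj1).
  have lt_psum k : i < k -> k <= j -> psum f k < psum g k.
    case: k => // k; rewrite ltnS leq_eqVlt => /predU1P[<- _|ik kj].
      by rewrite !psumS pi; lia.
    rewrite ltn_neqAle dom andbT; apply/negP => pk.
    by have := jmin k; rewrite /tight ik pk => /(_ isT); lia.
  (* The gap open before [j] closes at [j], so [g j < f j]. Domination one index later gives
     [f j.+1 <= g j.+1 <= g j < f j], so entry [j] can be lowered. *)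
  have gfj : g j < f j.
    by have := lt_psum j ij (leqnn _); move: pj; rewrite !psumS; lia.
  have fj : f j.+1 < f j.
    by have := dom j.+2; rewrite psumS [leqRHS]psumS pj; have := gd j; lia.
  pose f' k := f k + (k == i) - (k == j).
  have f'E k : f' k + (k == j) = f k + (k == i).
    by rewrite /f'; case: (k =P j) => [->|]; lia.
  have pf' k : psum f' k + (j < k) = psum f k + (i < k).
    by elim: k => [|k IH]; rewrite ?psum0 // !psumS; have := f'E k; lia.
  exists f', i; split; last by right; exists j; split=> //; lia.
    move=> k; have := f'E k; have := f'E k.+1; have := fd k; have := fi k.
    have [/eqP -> | ] := boolP (k == j); first by lia.
    by lia.
    by move=> k; have := pf' k; have := dom k; have := lt_psum k; lia.
  by split=> // [k|]; [have := pf' k|have := pf' i.+1]; lia.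
(* Without a tight index the gap stays open: from [n] on, the partial sums of [f] are constant while
   those of [g] do not decrease. *)
have lt_psum k : i < k -> psum f k < psum g k.
  case: k => // k; rewrite ltnS leq_eqVlt => /predU1P[<-|ik].
    by rewrite !psumS pi; lia.
  rewrite ltn_neqAle dom andbT; apply/negP => /eqP pk.
  have nt j : i < j -> j < n -> psum f j.+1 != psum g j.+1.
    move=> ij jn; move/hasPn: notight => /(_ j); rewrite mem_iota jn => /(_ isT).
    by rewrite /tight ij.
  have [kn|nk] := ltnP k n; first by have := nt k ik kn; rewrite pk eqxx.
  have [ni|] := leqP n i.+1; last first.
    move=> lin; have := nt n.-1; rewrite prednK; last by lia.
    have := psum_stable f0 (leq_trans nk (leqnSn k)).
    have := @psum_mono g n k.+1; have := dom n; lia.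
  have := psum_stable f0 (leq_trans nk (leqnSn k)).
  have := @psum_mono g i.+1 k.+1; have := psum_stable f0 ni.
  have : psum f i.+1 < psum g i.+1 by rewrite !psumS pi; lia.
  by lia.
pose f' k := f k + (k == i).
have pf' k : psum f' k = psum f k + (i < k).
  by elim: k => [|k IH]; rewrite ?psum0 // !psumS IH /f'; lia.
exists f', i; split; last by left.
  by move=> k; rewrite /f'; have := fd k; have := fi k; lia.
  by move=> k; rewrite pf'; have := dom k; have := lt_psum k; lia.
by split=> // [k|]; rewrite pf'; lia.
Qed.

(** The sum of the partial sums measures the progress of the climb towards the dominating
    sequence. *)
Lemma psum_lt f g i n : dominated f g -> psum f i < psum g i -> i < n ->
  psum (psum f) n < psum (psum g) n.
Proof.
move=> dom lt_i; elim: n => // n IH; rewrite ltnS !psumS leq_eqVlt.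
case/predU1P => [<-|/IH]; last by have := dom n; lia.
suff: psum (psum f) i <= psum (psum g) i by lia.
by apply: leq_sum => k _; exact: dom.
Qed.

Lemma tree_excess_psum n (e : rel 'I_n) (f : nat -> nat) : is_tree e ->
  (forall i : 'I_n, deg e i = (f i).+1) -> (psum f n).+2 = n.
Proof.
move=> te df; have := tree_handshake te.
have -> : \sum_x deg e x = psum f n + n.
  rewrite -[X in _ + X]card_ord -sum1_card /psum -big_split.
  by apply: eq_bigr => i _; rewrite df -addn1.
by lia.
Qed.

(** The excesses of a tree sum to its number of vertices minus two, so the padded sequence
    determines that number. *)
Lemma excess_size_uniq f n m : (psum f n).+2 = n -> (psum f m).+2 = m ->
  (forall i, n <= i -> f i = 0) -> (forall i, m <= i -> f i = 0) -> n = m.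
Proof.
move=> fn fm n0 m0; have [le1|/ltnW le1] := leqP n m.
  by move: fm; rewrite (psum_stable n0 le1); lia.
by move: fn; rewrite (psum_stable m0 le1); lia.
Qed.

End Majorization.

(** * Climbing to the dominating sequence *)

Section Climb.
Variables (R : rcfType) (g : nat -> nat) (n' : nat).
Hypotheses (gd : nonincr g) (g0 : forall i, (n' <= i)%N -> g i = 0%N).
Hypothesis gn : (psum g n').+2 = n'.

(** Induction on a strict bound [m] for the gap between the double sums. Summing up to [n'.+1]
    detects a step at any [i < n'], since it raises the partial sum at [i.+1]. *)
Lemma dominated_tree_lt m n (e : rel 'I_n) (f : nat -> nat) (l : R) :
    is_tree e -> is_lambda e l -> (forall i : 'I_n, deg e i = (f i).+1) ->
    (forall i, (n <= i)%N -> f i = 0%N) -> nonincr f -> dominated f g ->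
    (psum (psum g) n'.+1 < psum (psum f) n'.+1 + m)%N ->
  f =1 g \/ exists2 e' : rel 'I_n', is_tree e' &
    (forall i : 'I_n', deg e' i = (g i).+1) /\ forall l', is_lambda e' l' -> l < l'.
Proof.
elim: m n e f l => [|m IH] n e f l te el df f0 fd dom hm.
  have : (psum (psum f) n'.+1 <= psum (psum g) n'.+1)%N.
    by apply: leq_sum => k _; exact: dom.
  by lia.
(* Both sequences vanish from [n + n'] on, so equality is decided on a finite range. *)
have [/forallP eqfg|] := boolP [forall i : 'I_(n + n'), f i == g i].
  left=> i; have [lt_i|le_i] := ltnP i (n + n').
    exact/eqP/(eqfg (Ordinal lt_i)).
  by rewrite f0 ?g0 //; lia.
rewrite negb_forall => /existsP[i0 /eqP /(dominated_step fd gd dom f0)].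
move=> [f' [i [fd' dom' [pi fgi ff' lti] step]]]; right.
have in' : (i < n')%N by rewrite ltnNge; apply/negP => /g0 gi; rewrite gi in fgi.
have fn := tree_excess_psum te df.
(* The first [i] entries of [g] are positive, so [i <= psum g i = psum f i]; if [n <= i], the latter
   is only [n - 2]. *)
have lt_in : (i < n)%N.
  rewrite ltnNge; apply/negP => ni.
  have := psum_stable f0 ni; rewrite pi.
  have : (i <= psum g i)%N.
    by apply: psum_pos => k ki; have := nonincr_le gd (ltnW ki); lia.
  by lia.
have [n1 [e1 [te1 df1 f1 lt1]]] : exists n1 (e1 : rel 'I_n1),
    [/\ is_tree e1, forall k : 'I_n1, deg e1 k = (f' k).+1,
        forall k, (n1 <= k)%N -> f' k = 0%N & forall l1, is_lambda e1 l1 -> l < l1].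
  pose v := Ordinal lt_in.
  case: step => [f'E|[j [ij fj f'E]]].
    exists n.+1, (add_leaf e v); split.
    - exact: add_leaf_tree.
    - move=> k; rewrite f'E; case: (unliftP ord_max k) => [a|] ->.
        by rewrite add_leaf_deg_lift df lift_max -val_eqE.
      by rewrite add_leaf_deg_max f0 //=; lia.
    - by move=> k nk; rewrite f'E f0; lia.
    - by move=> l1; exact: add_leaf_lambda.
  have lt_jn : (j < n)%N by rewrite ltnNge; apply/negP => /f0 fj0; rewrite fj0 in fj.
  pose w := Ordinal lt_jn.
  have vw : v != w by rewrite -val_eqE /=; lia.
  have [|e1 [te1 dv dw dx lt1]] := tree_transfer te el vw.
    by rewrite !df /=; have := nonincr_le fd (ltnW ij); lia.
  exists n, e1; split=> // [k|k nk]; last by have := f'E k; rewrite f0 //; lia.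
  have := f'E k; have [-> |kv] := eqVneq k v; first by rewrite dv df /=; lia.
  have [-> |kw] := eqVneq k w; first by rewrite dw df /=; lia.
  by rewrite dx // df; move: kv kw; rewrite -!val_eqE /=; lia.
have [l1 el1] := lambda_exists R te1.
have [|f'g|[e' te' [dg' lt']]] := IH n1 e1 f' l1 te1 el1 df1 f1 fd' dom'.
- by have := psum_lt ff' lti (_ : i.+1 < n'.+1)%N; lia.
- have n1E : n1 = n'.
    apply: excess_size_uniq gn _ g0 => //; last by move=> a /f1; rewrite f'g.
    by apply: (tree_excess_psum te1) => k; rewrite df1 f'g.
  move: e1 te1 df1 lt1 {el1 IH f1}; rewrite n1E => e1 te1 df1 lt1.
  by exists e1 => //; split=> // k; rewrite df1 f'g.
exists e' => //; split=> // l' /lt'; apply: lt_trans; exact: lt1.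
Qed.
End Climb.

(** * From degree lists to excess sequences *)

Lemma tree_deg_gt0 n (e : rel 'I_n) x : is_tree e -> (1 < n)%N -> (0 < deg e x)%N.
Proof.
move=> te n1.
(* Rooted elsewhere than at [x], the tree gives [x] a parent. *)
have [r xr] : exists r, x != r.
  have [x0|x0] := eqVneq (val x) 0%N.
    by exists (Ordinal n1); rewrite -val_eqE /= x0.
  by exists (Ordinal te.1); rewrite -val_eqE.
have [p [h [eE _ hp]]] := tree_parent te r.
by rewrite (parent_rel_deg eE (h := h)) ?xr // => y /hp ->.
Qed.

Lemma relabel_lambda_ge (R : rcfType) n (e : rel 'I_n) (s : {perm 'I_n}) (l l' : R) :
    is_tree e -> is_lambda e l -> is_lambda (fun x y => e (s x) (s y)) l' ->
  l <= l'.
Proof.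
move=> te el el'; have [f [f0 fE]] := tree_perron te el.
have := tree_energy_le (relabel_tree s te) el' (f \o s).
rewrite relabel_energy relabel_sqnorm (eigen_energy _ fE); last by case: te => _ [[]].
rewrite ler_pM2r ?ler_pM2l // /sqnorm (bigD1 (Ordinal te.1)) //=.
by rewrite ltr_wpDr ?exprn_gt0 // sumr_ge0 // => i _; exact: sqr_ge0.
Qed.

(** [in_T] prescribes the degrees only up to order; a relabelling puts the degree at position [i] of
    [pi] on vertex [i]. *)
Lemma in_T_sorted (R : rcfType) pi (e : rel 'I_(size pi)) : in_T pi e ->
  exists2 e' : rel 'I_(size pi), is_tree e' &
    (forall i : 'I_(size pi), deg e' i = nth 0%N pi i) /\
    forall l l' : R, is_lambda e l -> is_lambda e' l' -> l <= l'.
Proof.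
move=> [te pe].
have sz : size [seq deg e i | i <- enum 'I_(size pi)] = size pi.
  by rewrite size_map size_enum_ord.
have /tuple_permP[s sE] : perm_eq pi (Tuple (introT eqP sz)) by rewrite perm_sym.
exists (fun x y => e (s x) (s y)); first exact: relabel_tree.
split=> [i|l l']; last exact: relabel_lambda_ge.
rewrite relabel_deg (congr1 (fun t => nth 0%N t i) sE) -(tnth_nth 0%N).
rewrite tnth_mktuple (tnth_nth 0%N) /=.
by rewrite (nth_map i) ?size_enum_ord // nth_ord_enum.
Qed.

Lemma in_T_of_deg pi (e : rel 'I_(size pi)) : is_tree e ->
  (forall i : 'I_(size pi), deg e i = nth 0%N pi i) -> in_T pi e.
Proof.
move=> te de; split=> //; rewrite /has_deg_seq (eq_map de).
by rewrite map_comp val_enum_ord -/(mkseq _ _) mkseq_nth.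
Qed.

Lemma sorted_excess_nonincr pi : sorted geq pi -> nonincr (fun i => (nth 0%N pi i).-1).
Proof.
move=> /(sortedP 0%N) srt i; have [/srt /=|le_i] := ltnP i.+1 (size pi); first by lia.
by rewrite [nth _ _ i.+1]nth_default.
Qed.

Lemma psum_excess pi k : (forall i, (i < size pi)%N -> (0 < nth 0 pi i)%N) ->
  (k <= size pi)%N ->
  (psum (fun i => (nth 0 pi i).-1) k + k = \sum_(i < k) nth 0 pi i)%N.
Proof.
move=> pos; elim: k => [|k IH] kn; first by rewrite psum0 big_ord0.
by rewrite psumS big_ord_recr -IH ?(ltnW kn) //=; have := pos k kn; lia.
Qed.

Theorem theorem2 (R : rcfType) (pi pi' : seq nat)
  (Hpi : tree_seq pi) (Hpi' : tree_seq pi')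
  (Hs : sorted geq pi) (Hs' : sorted geq pi')
  (Hneq : pi != pi') (Hmaj : majorized pi pi')
  (G : rel 'I_(size pi)) (G' : rel 'I_(size pi'))
  (HG : extremal R pi G) (HG' : extremal R pi' G')
  (l l' : R) (Hl : is_lambda G l) (Hl' : is_lambda G' l') :
  l < l'.
Proof.
have [TG _] := HG; have [TG' ext'] := HG'; have [le_size maj] := Hmaj.
have [e te [de le_l]] := in_T_sorted R TG.
have [e' te' [de' _]] := in_T_sorted R TG'.
have [l1 el1] := lambda_exists R te.
(* A single vertex has degree 0, so it has no excess and is treated apart. *)
have [n1|n_le1] := ltnP 1 (size pi); last first.
  have n0 := te.1; have nE : size pi = 1%N by lia.
  have n'1 : (1 < size pi')%N.
    rewrite ltnNge; apply/negP => n'_le1; case/eqP: Hneq.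
    have deg0 q (E : rel 'I_(size q)) : is_tree E ->
        (forall i : 'I_(size q), deg E i = nth 0%N q i) -> (size q <= 1)%N -> q = [:: 0%N].
      move=> tE dE; have := tE.1; have := tree_handshake tE.
      rewrite (eq_bigr _ (fun i _ => dE i)) -(big_mkord predT (nth 0%N q)).
      case: q {E tE dE} => [|a []] //=; rewrite big_nat1 /=.
      by case: a.
    by rewrite (deg0 _ _ te de) // (deg0 _ _ te' de').
  have [f [f0 fE]] := tree_perron te el1.
  have l10 : l1 = 0.
    have := fE (Ordinal n0); rewrite /signless_lapl big_pred0 => [/esym/eqP|y].
      by rewrite mulf_eq0 [f _ == 0]gt_eqF // orbF => /eqP.
    have -> : y = Ordinal n0 by apply/val_inj => /=; have := ltn_ord y; lia.
    by case: te => _ [[_ /(_ (Ordinal n0))/negPf]].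
  have le1 := le_l _ _ Hl el1; rewrite l10 in le1.
  apply: (le_lt_trans le1).
  have tG' := TG'.1.
  (* The eigenvalue of the single vertex is 0; the constant vector 1 beats it, since every vertex of
     [G'] has a neighbour. *)
  apply: (@lambda_gt _ _ _ _ _ (fun=> 1) (Ordinal tG'.1) tG' Hl').
    by rewrite mulr0 mul0r; apply: sumr_ge0 => x _; apply: sumr_ge0 => y _; exact: sqr_ge0.
  rewrite mul0r /signless_lapl sumr_const -cardsE pmulrn_lgt0 ?tree_deg_gt0 //.
  by rewrite addr_gt0.
pose f i := (nth 0%N pi i).-1; pose g i := (nth 0%N pi' i).-1.
have n'1 : (1 < size pi')%N by exact: leq_trans le_size.
have pos i : (i < size pi)%N -> (0 < nth 0 pi i)%N.
  by move=> lt_i; rewrite -(de (Ordinal lt_i)) tree_deg_gt0.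
have pos' i : (i < size pi')%N -> (0 < nth 0 pi' i)%N.
  by move=> lt_i; rewrite -(de' (Ordinal lt_i)) tree_deg_gt0.
have df (i : 'I_(size pi)) : deg e i = (f i).+1 by rewrite de /f prednK // pos.
have dg (i : 'I_(size pi')) : deg e' i = (g i).+1 by rewrite de' /g prednK // pos'.
have f0 i : (size pi <= i)%N -> f i = 0%N by move=> le_i; rewrite /f nth_default.
have g0 i : (size pi' <= i)%N -> g i = 0%N by move=> le_i; rewrite /g nth_default.
have fn := tree_excess_psum te df; have gn := tree_excess_psum te' dg.
have fd : nonincr f := sorted_excess_nonincr Hs.
have gd : nonincr g := sorted_excess_nonincr Hs'.
have dom : dominated f g.
  case=> [|k]; first by rewrite !psum0.
  have [lt_k|le_k] := ltnP k (size pi).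
    have := maj k lt_k; rewrite -!psum_excess -/f -/g //; last exact: leq_trans le_size.
    by rewrite leq_add2r.
  (* Past [size pi] the partial sums of [f] stay at [size pi - 2]. If [g k.+1 = 0], that of [g] has
     reached [size pi' - 2]; otherwise its [k.+1] positive terms give at least [k.+1]. *)
  rewrite (psum_stable f0 (leqW le_k)).
  have [g1|g1] := posnP (g k.+1).
    have gk a : (k.+1 <= a)%N -> g a = 0%N.
      by move=> /(nonincr_le gd); rewrite g1 leqn0 => /eqP.
    have [le_k'|/ltnW le_k'] := leqP k.+1 (size pi').
      by move: gn; rewrite (psum_stable gk le_k'); lia.
    by rewrite (psum_stable g0 le_k'); lia.
  have : (k.+1 <= psum g k.+1)%N.
    by apply: psum_pos => a /ltnW/(nonincr_le gd); exact: leq_trans.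
  by lia.
(* This [m] makes the bound on the measure trivial. *)
have [|fg|[e2 te2 [de2 lt2]]] :=
  dominated_tree_lt gd g0 gn (m := (psum (psum g) (size pi').+1).+1) te el1 df f0 fd dom.
- by lia.
- case/eqP: Hneq; apply: (@eq_from_nth _ 0%N) => [|i lt_i].
    apply: excess_size_uniq fn _ f0 _ => [|i]; last by rewrite fg; exact: g0.
    by apply: (tree_excess_psum te') => i; rewrite dg fg.
  have := fg i; rewrite /f /g; have := pos i lt_i; have := pos' i (leq_trans lt_i le_size).
  by lia.
(* [e2] competes with the extremal [G'], so [l <= l1 < l2 <= l']. *)
have [l2 el2] := lambda_exists R te2.
apply: le_lt_trans (le_l _ _ Hl el1) _; apply: lt_le_trans (lt2 _ el2) _.
apply: (ext' e2) => //; apply: in_T_of_deg => // i.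
by rewrite de2 /g prednK // pos'.
Qed.
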